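(* Let $N=2m$ with $m\ge1$, let $\mathcal T\in\mathbb H^{I_1\times\cdots\times I_N}$ be a quaternion tensor, and let $1\le I_k'\le I_k$ for $k=1,\ldots,N$. Let $\hat{\mathcal T}$ be an $(I_1',I_2',\ldots,I_N')$ truncated TS-QHOSVD of $\mathcal T$, i.e. $$\hat{\mathcal T}=\hat{\mathbf U}_m\times_m^L\cdots\hat{\mathbf U}_1\times_1^L\hat{\mathcal S}\times_N^R\hat{\mathbf V}_N^H\cdots\times_{m+1}^R\hat{\mathbf V}_{m+1}^H,$$ where $\hat{\mathcal S},\hat{\mathbf U}_1,\ldots,\hat{\mathbf U}_m,\hat{\mathbf V}_{m+1},\ldots,\hat{\mathbf V}_N$ are computed by the truncated TS-QHOSVD procedure (described in the context). Then $$\|\mathcal T-\hat{\mathcal T}\|_F^2\le\sum_{k=I_1'+1}^{I_1}\big((\sigma_k^L)^{(1)}\big)^2+\cdots+\sum_{k=I_m'+1}^{I_m}\big((\sigma_k^L)^{(m)}\big)^2+\sum_{k=I_{m+1}'+1}^{I_{m+1}}\big((\sigma_k^R)^{(m+1)}\big)^2+\cdots+\sum_{k=I_N'+1}^{I_N}\big((\sigma_k^R)^{(N)}\big)^2,$$ where $(\sigma_k^L)^{(i)}$ is the $k$-th largest singular value of $(\hat{\mathbf L}_{i+1})^L_{[i]}$ ($i=1,\ldots,m$) and $(\sigma_k^R)^{(j)}$ is the $k$-th largest singular value of $(\hat{\mathbf R}_{j-1})^R_{[j]}$ ($j=m+1,\ldots,N$).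
   Context: $\mathbb H$ denotes the (non-commutative) real quaternions, $\bar q$ the quaternion conjugate, $|q|=\sqrt{q\bar q}$; $(\cdot)^T$ is the transpose (without conjugation) and $(\cdot)^H$ the conjugate transpose of a quaternion matrix. A square quaternion matrix $\mathbf U$ is unitary if $\mathbf U^H\mathbf U=\mathbf I$. The Frobenius norm of a quaternion tensor is $\|\mathcal A\|_F^2=\sum|a_{i_1\cdots i_N}|^2$. Unfoldings. For $\mathcal T\in\mathbb H^{I_1\times\cdots\times I_N}$, the left mode-$k$ unfolding $\mathbf T^L_{[k]}\in\mathbb H^{I_k\times I_1\cdots I_{k-1}I_{k+1}\cdots I_N}$ has $(i_k,j)$ entry $t_{i_1\cdots i_N}$, where $j=1+\sum_{l\ne k}(i_l-1)J_l$, $J_l=\prod_{s<l,\,s\ne k}I_s$. The right mode-$k$ unfolding is $\mathbf T^R_{[k]}=(\mathbf T^L_{[k]})^T$. Unfoldings of tensors $\hat{\mathcal L}_i,\hat{\mathcal R}_j$ are written $(\hat{\mathbf L}_i)^L_{[k]}$, $(\hat{\mathbf R}_j)^R_{[k]}$. Mode-$k$ products. For $\mathbf U\in\mathbb H^{J\times I_k}$, the left mode-$k$ product $\mathbf U\times_k^L\mathcal T$ has entries $(\mathbf U\times_k^L\mathcal T)_{i_1\cdots i_{k-1}ji_{k+1}\cdots i_N}=\sum_{i_k}u_{ji_k}t_{i_1\cdots i_N}$. For $\mathbf V\in\mathbb H^{I_k\times J}$, the right mode-$k$ product $\mathcal T\times_k^R\mathbf V$ has entries $(\mathcal T\times_k^R\mathbf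 V)_{i_1\cdots i_{k-1}ji_{k+1}\cdots i_N}=\sum_{i_k}t_{i_1\cdots i_N}v_{i_kj}$. In a chain of products, left products are applied starting with the one closest to the tensor (right to left) and right products starting with the one closest to the tensor (left to right); left products commute with right products by associativity. Quaternion SVD. Every quaternion matrix $\mathbf M$ can be written as $\mathbf M=\mathbf U\Sigma\mathbf V^H$ with $\mathbf U,\mathbf V$ unitary and $\Sigma$ real (rectangular) diagonal with non-negative diagonal entries (singular values) in descending order. The leading $r$ left (right) singular vectors are the first $r$ columns of $\mathbf U$ (of $\mathbf V$). Singular values beyond the number available are taken to be zero. Truncated TS-QHOSVD procedure ($N=2m$). Set $\hat{\mathcal L}_{m+1}=\mathcal T=\hat{\mathcal R}_m$. For $i=m,m-1,\ldots,1$: let $\hat{\mathbf U}_i\in\mathbb H^{I_i\times I_i'}$ consist of the leading $I_i'$ left singular vectors of $(\hat{\mathbf L}_{i+1})^L_{[i]}$, and set $\hat{\mathcal L}_i=\hat{\mathbf U}_i^H\times_i^L\hat{\mathcal L}_{i+1}$. For $j=m+1,\ldots,N$: let $\hat{\mathbf V}_j\in\mathbb H^{I_j\times I_j'}$ consist of the leading $I_j'$ right singular vectors of $(\hat{\mathbf R}_{j-1})^R_{[j]}$, and set $\hat{\mathcal R}_j=\hat{\mathcal R}_{j-1}\times_j^R\hat{\mathbf V}_j$. The core tensor is $$\hat{\mathcal S}=\hat{\mathbf U}_1^H\times_1^L\cdots\hat{\mathbf U}_m^H\times_m^L\hat{\mathcal R}_N=\hat{\mathbf U}_1^H\times_1^L\cdots\hat{\mathbf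 U}_m^H\times_m^L\mathcal T\times_{m+1}^R\hat{\mathbf V}_{m+1}\cdots\times_N^R\hat{\mathbf V}_N\in\mathbb H^{I_1'\times\cdots\times I_N'} .$$ *)

(* Defs.v *)
From HB Require Import structures.
From mathcomp Require Import all_boot all_order all_algebra.
From mathcomp Require Import reals.
From mathcomp Require ring.

Set Implicit Arguments.
Unset Strict Implicit.
Unset Printing Implicit Defensive.

Import Order.TTheory GRing.Theory Num.Theory.
Local Open Scope ring_scope.

(* Quat a b c d stands for a + b i + c j + d k. *)
Record quat (R : Type) : Type := Quat { qre : R; qi : R; qj : R; qk : R }.

Section QuatRing.
Variable R : realType.
Implicit Types p q r : quat R.

Definition prod_of_quat q : R * R * R * R := (qre q, qi q, qj q, qk q).
Definition quat_of_prod (x : R * R * R * R) : quat R :=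
  let: (a, b, c, d) := x in Quat a b c d.

Lemma prod_of_quatK : cancel prod_of_quat quat_of_prod.
Proof. by case. Qed.

HB.instance Definition _ := Choice.copy (quat R) (can_type prod_of_quatK).

Definition qadd p q :=
  Quat (qre p + qre q) (qi p + qi q) (qj p + qj q) (qk p + qk q).
Definition qopp q := Quat (- qre q) (- qi q) (- qj q) (- qk q).

Fact qaddA : associative qadd.
Proof. by move=> p q r; rewrite /qadd /= !addrA. Qed.
Fact qaddC : commutative qadd.
Proof.
by move=> p q; congr Quat; apply: addrC.
Qed.
Fact qadd0 : left_id (Quat 0 0 0 0) qadd.
Proof. by case=> a b c d; rewrite /qadd /= !add0r. Qed.
Fact qaddN : left_inverse (Quat 0 0 0 0) qopp qadd.
Proof. by move=> q; rewrite /qadd /= !addNr. Qed.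

HB.instance Definition _ :=
  GRing.isZmodule.Build (quat R) qaddA qaddC qadd0 qaddN.

Definition qmul p q :=
  Quat (qre p * qre q - qi p * qi q - qj p * qj q - qk p * qk q)
       (qre p * qi q + qi p * qre q + qj p * qk q - qk p * qj q)
       (qre p * qj q - qi p * qk q + qj p * qre q + qk p * qi q)
       (qre p * qk q + qi p * qj q - qj p * qi q + qk p * qre q).

Import ring.

Fact qmulA : associative qmul.
Proof. by move=> p q r; rewrite /qmul /=; congr Quat; ring. Qed.
Fact qmul1 : left_id (Quat 1 0 0 0) qmul.
Proof. by case=> a b c d; rewrite /qmul /=; congr Quat; ring. Qed.
Fact qmulr1 : right_id (Quat 1 0 0 0) qmul.
Proof. by case=> a b c d; rewrite /qmul /=; congr Quat; ring. Qed.
Fact qmulDl : left_distributive qmul qadd.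
Proof. by move=> p q r; rewrite /qmul /qadd /=; congr Quat; ring. Qed.
Fact qmulDr : right_distributive qmul qadd.
Proof. by move=> p q r; rewrite /qmul /qadd /=; congr Quat; ring. Qed.
Fact quat1_neq0 : Quat 1 0 0 0 != 0 :> quat R.
Proof. by apply/eqP => -[] /eqP; rewrite oner_eq0. Qed.

HB.instance Definition _ := GRing.Zmodule_isNzRing.Build (quat R)
  qmulA qmul1 qmulr1 qmulDl qmulDr quat1_neq0.

Definition qreal (a : R) : quat R := Quat a 0 0 0.

Definition qconj q : quat R := Quat (qre q) (- qi q) (- qj q) (- qk q).

(* q * qconj q is real (mulq_conj below), so qre only changes its type. *)
Definition qabs q : R := Num.sqrt (qre (q * qconj q)).

Lemma mulq_conj q :
  q * qconj q = qreal (qre q ^+ 2 + qi q ^+ 2 + qj q ^+ 2 + qk q ^+ 2).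
Proof.
by rewrite /GRing.mul /= /qmul /qconj /qreal /=; congr Quat; ring.
Qed.

End QuatRing.

Section QuatMatrix.
Variable R : realType.
Local Notation H := (quat R).

Definition hadj p q (M : 'M[H]_(p, q)) : 'M[H]_(q, p) :=
  map_mx (@qconj R) M^T.

Definition qunitary p (U : 'M[H]_p) : Prop := hadj U *m U = 1%:M.

(* M = U Sigma V^H. The k-th largest singular value is [s k] with k counted
   from 0; s vanishes beyond the min(p, q) available values. *)
Definition is_qsvd p q (M : 'M[H]_(p, q))
    (U : 'M[H]_p) (s : nat -> R) (V : 'M[H]_q) : Prop :=
  [/\ qunitary U /\ qunitary V,
      forall k, 0 <= s k,
      forall k l, (k <= l)%N -> s l <= s k,
      forall k, (minn p q <= k)%N -> s k = 0 &
      M = U *m (\matrix_(i < p, j < q)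
                  if i == j :> nat then qreal (s i) else 0) *m hadj V].

Definition singular_values p q (M : 'M[H]_(p, q)) (s : nat -> R) : Prop :=
  exists U V, is_qsvd M U s V.

Definition leading_cols p r (W : 'M[H]_(p, r)) (U : 'M[H]_p) : Prop :=
  forall (i : 'I_p) (c : 'I_r) (c' : 'I_p), c = c' :> nat -> W i c = U i c'.

Definition leading_lsv p q r (M : 'M[H]_(p, q)) (W : 'M[H]_(p, r)) : Prop :=
  (r <= p)%N /\ exists U s V, is_qsvd M U s V /\ leading_cols W U.

Definition leading_rsv p q r (M : 'M[H]_(p, q)) (W : 'M[H]_(q, r)) : Prop :=
  (r <= q)%N /\ exists U s V, is_qsvd M U s V /\ leading_cols W V.

End QuatMatrix.

Section MixedRadix.
Local Open Scope nat_scope.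
Variables (P : pred nat) (d : nat -> nat).
Local Notation weight l := (\prod_(s < l | P s) d s).
Local Notation value a n := (\sum_(l < n | P l) a l * weight l).

Lemma mixed_radix_lt n (a : nat -> nat) :
  (forall l, l < n -> P l -> a l < d l) -> value a n < weight n.
Proof.
elim: n => [|n IHn] lt_ad; first by rewrite !big_ord0.
have {}IHn : value a n < weight n by apply: IHn => l /leqW; apply: lt_ad.
rewrite !(big_mkcond (fun l : 'I_n.+1 => P l)) !big_ord_recr /= -!big_mkcond /=.
case: ifP => [Pn|_]; last by rewrite addn0 muln1.
have lt_n := lt_ad n (ltnSn n) Pn.
apply: (@leq_trans ((a n).+1 * weight n)); first by rewrite mulSn ltn_add2r.
by rewrite mulnC leq_mul2l lt_n orbT.
Qed.

Lemma mixed_radix_inj n (a b : nat -> nat) :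
  (forall l, l < n -> P l -> a l < d l) ->
  (forall l, l < n -> P l -> b l < d l) ->
  value a n = value b n -> forall l, l < n -> P l -> a l = b l.
Proof.
elim: n => [//|n IHn] lt_ad lt_bd.
have lt_ad' l : l < n -> P l -> a l < d l by move=> /leqW; apply: lt_ad.
have lt_bd' l : l < n -> P l -> b l < d l by move=> /leqW; apply: lt_bd.
have lta := mixed_radix_lt lt_ad'; have ltb := mixed_radix_lt lt_bd'.
rewrite !(big_mkcond (fun l : 'I_n.+1 => P l)) !big_ord_recr /= -!big_mkcond /=.
have w_gt0 : 0 < weight n by apply: leq_ltn_trans lta.
case: ifP => [Pn|nPn] eqv l; last first.
  rewrite ltnS leq_eqVlt => /orP[/eqP->|ltl]; first by rewrite nPn.
  by apply: IHn => //; move: eqv; rewrite !addn0.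
have eqn : a n = b n.
  have := congr1 (divn^~ (weight n)) eqv; rewrite /= ![_ + _ * _]addnC.
  by rewrite !divnMDl // !divn_small // !addn0.
rewrite ltnS leq_eqVlt => /orP[/eqP-> //|ltl].
by apply: IHn => //; move: eqv; rewrite eqn => /addIn.
Qed.

Lemma mixed_radix_digits n j :
  value (fun l => j %/ weight l %% d l) n = j %% weight n.
Proof.
elim: n => [|n IHn]; first by rewrite !big_ord0 modn1.
rewrite !(big_mkcond (fun l : 'I_n.+1 => P l)) !big_ord_recr /= -!big_mkcond /=.
rewrite IHn; case: ifP => _; last by rewrite addn0 muln1.
rewrite modn_divl [(d n * _)%N]mulnC -(modn_dvdm j (dvdn_mulr (d n) (dvdnn _))).
by rewrite addnC -divn_eq.
Qed.
End MixedRadix.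

Section Tensor.
Variables (R : realType) (N : nat).
Local Notation H := (quat R).
Implicit Types (d : 'I_N -> nat) (k : 'I_N).

Definition mindex d : finType := {dffun forall l : 'I_N, 'I_(d l)}.
Definition qtensor d : Type := {ffun mindex d -> H}.

Definition frob d (X : qtensor d) : R := Num.sqrt (\sum_a qabs (X a) ^+ 2).

(* The column index of the mode-k unfolding, with all indices counted from 0. *)
Definition colidx d k (a : mindex d) : nat :=
  (\sum_(l | l != k) a l * \prod_(s : 'I_N | (s < l)%N && (s != k)) d s)%N.

Let nat_dims d (l : nat) : nat := if insub l is Some x then d x else 0%N.
Let nat_index d (a : mindex d) (l : nat) : nat :=
  if insub l is Some x then a x else 0%N.

Let nat_colidx d k (a : mindex d) :
  colidx k a = (\sum_(l < N | l != k :> nat)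
    nat_index a l * \prod_(s < l | s != k :> nat) nat_dims d s)%N.
Proof.
apply: eq_bigr => l _; rewrite /nat_index valK; congr (_ * _)%N.
rewrite (big_ord_widen_cond N (fun s => s != k :> nat) (nat_dims d)); last first.
  exact: ltnW (ltn_ord l).
by apply: eq_big => [s|s _]; [rewrite andbC | rewrite /nat_dims valK].
Qed.

Let nat_size d k :
  (\prod_(l | l != k) d l = \prod_(l < N | l != k :> nat) nat_dims d l)%N.
Proof. by apply: eq_bigr => s _; rewrite /nat_dims valK. Qed.

Lemma colidx_lt d k (a : mindex d) :
  (colidx k a < \prod_(l | l != k) d l)%N.
Proof.
rewrite nat_colidx nat_size.
apply: (@mixed_radix_lt (fun s => s != k :> nat)) => l ltlN _.
by rewrite /nat_index /nat_dims; case: insubP => [x _ _|/negP//].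
Qed.

Lemma mode_index_inj d k (a b : mindex d) :
  a k = b k -> colidx k a = colidx k b -> a = b.
Proof.
move=> eqk; rewrite !nat_colidx => eqc; apply/ffunP => l.
case: (eqVneq l k) => [-> //|neq_lk]; apply: val_inj.
have := @mixed_radix_inj (fun s => s != k :> nat) (nat_dims d) N
  (nat_index a) (nat_index b) _ _ eqc l (ltn_ord l) neq_lk.
rewrite /nat_index !valK; apply => s ltsN _;
  by rewrite /nat_dims; case: insubP => [x _ _|/negP//].
Qed.

Lemma mode_index_exists d k (i : 'I_(d k)) (j : nat) :
  (j < \prod_(l | l != k) d l)%N ->
  exists a : mindex d, a k = i /\ colidx k a = j.
Proof.
move=> ltj; pose w (l : 'I_N) :=
  (\prod_(s < l | s != k :> nat) nat_dims d s)%N.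
have d_gt0 l : (0 < d l)%N.
  have : (0 < \prod_(l | l != k) d l)%N by case: (X in (_ < X)%N) ltj.
  case: (eqVneq l k) => [-> _|neq_lk]; first by case: (d k) i => [[]|].
  by rewrite (bigD1 l) //= muln_gt0 => /andP[].
pose dig l : 'I_(d l) := Ordinal (ltn_pmod (j %/ w l) (d_gt0 l)).
have exa : exists a : mindex d,
    a k = i /\ forall l, l != k -> a l = (j %/ w l %% d l)%N :> nat.
  exists [ffun l => match k =P l with
    | ReflectT e => ecast z 'I_(d z) e i | _ => dig l end].
  split=> [|l neq_lk]; rewrite ffunE; case: eqP => // e.
    by rewrite (eq_axiomK e).
  by rewrite -e eqxx in neq_lk.
case: exa => a [aki al]; exists a; split=> //.
rewrite nat_colidx -[RHS](modn_small ltj) nat_size.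
rewrite -(mixed_radix_digits (fun s => s != k :> nat)).
apply: eq_bigr => l neq_lk; congr (_ * _)%N.
by rewrite /nat_index valK al // /nat_dims valK.
Qed.

(* By mode_index_exists and mode_index_inj exactly one multi-index
   satisfies the test, so the default value 0 is never taken. *)
Definition unfoldL d k (X : qtensor d) :
    'M[H]_(d k, (\prod_(l | l != k) d l)%N) :=
  \matrix_(i, j)
    if [pick a : mindex d | (a k == i) && (colidx k a == j :> nat)] is Some a
    then X a else 0.

Definition unfoldR d k (X : qtensor d) :
    'M[H]_((\prod_(l | l != k) d l)%N, d k) := (unfoldL k X)^T.

Definition agree_off k d d' (a : mindex d) (b : mindex d') : bool :=
  [forall l : 'I_N, (l != k) ==> (a l == b l :> nat)].

(* The tensor resulting from a mode-k product may have any dimensions d' with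
   d' l = d l for l != k. The b that agree with a off k are then the
   multi-indices obtained from a by letting the k-th index run over 'I_(d k). *)
Definition lmodeprod d d' k (A : 'M[H]_(d' k, d k)) (X : qtensor d) :
    qtensor d' :=
  [ffun a => \sum_(b : mindex d | agree_off k a b) A (a k) (b k) * X b].

Definition rmodeprod d d' k (X : qtensor d) (B : 'M[H]_(d k, d' k)) :
    qtensor d' :=
  [ffun a => \sum_(b : mindex d | agree_off k a b) X b * B (b k) (a k)].

End Tensor.

Section TSQHOSVD.
Variables (R : realType) (m : nat).
Local Notation H := (quat R).
Local Notation N := (m + m)%N.
(* lmode i and rmode i are the modes i and m + i, for i < m. *)
Definition lmode : 'I_m -> 'I_N := @lshift m m.
Definition rmode : 'I_m -> 'I_N := @rshift m m.

Variables I I' : 'I_N -> nat.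
Variable U : forall i : 'I_m, 'M[H]_(I (lmode i), I' (lmode i)).
Variable V : forall j : 'I_m, 'M[H]_(I (rmode j), I' (rmode j)).

(* Dimensions once the modes in t are truncated. dims [::] is convertible
   to I. *)
Definition dims (t : seq 'I_N) (l : 'I_N) : nat :=
  if l \in t then I' l else I l.

(* U i and V j seen as matrices from the dimension of their mode with the modes
   in t truncated, to the one with that mode truncated as well. These dimensions
   are equal to those of U i, V j (when the mode is not in t), but not
   convertible to them: conform_mx is the cast along these equalities. *)
Definition castU (t : seq 'I_N) (i : 'I_m) :
    'M[H]_(dims t (lmode i), dims (lmode i :: t) (lmode i)) :=
  conform_mx 0 (U i).
Definition castV (t : seq 'I_N) (j : 'I_m) :
    'M[H]_(dims t (rmode j), dims (rmode j :: t) (rmode j)) :=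
  conform_mx 0 (V j).

Lemma castUE t i (a : 'I_(dims t (lmode i)))
    (b : 'I_(dims (lmode i :: t) (lmode i)))
    (a' : 'I_(I (lmode i))) (b' : 'I_(I' (lmode i))) :
  lmode i \notin t ->
  a = a' :> nat -> b = b' :> nat -> castU t i a b = U i a' b'.
Proof.
move=> i_t eqa eqb; rewrite /castU /conform_mx.
have e1 : I (lmode i) = dims t (lmode i) by rewrite /dims (negbTE i_t).
have e2 : I' (lmode i) = dims (lmode i :: t) (lmode i).
  by rewrite /dims inE eqxx.
case: eqP => // {}e1; case: eqP => // {}e2; rewrite castmxE.
by congr (U i _ _); apply: val_inj.
Qed.

Lemma castVE t j (a : 'I_(dims t (rmode j)))
    (b : 'I_(dims (rmode j :: t) (rmode j)))
    (a' : 'I_(I (rmode j))) (b' : 'I_(I' (rmode j))) :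
  rmode j \notin t ->
  a = a' :> nat -> b = b' :> nat -> castV t j a b = V j a' b'.
Proof.
move=> j_t eqa eqb; rewrite /castV /conform_mx.
have e1 : I (rmode j) = dims t (rmode j) by rewrite /dims (negbTE j_t).
have e2 : I' (rmode j) = dims (rmode j :: t) (rmode j).
  by rewrite /dims inE eqxx.
case: eqP => // {}e1; case: eqP => // {}e2; rewrite castmxE.
by congr (V j _ _); apply: val_inj.
Qed.

(* For s = [:: i1; ...; ip],
     lcompress s X = U_i1^H x_i1 (... (U_ip^H x_ip X)),
     lexpand s X   = U_ip x_ip (... (U_i1 x_i1 X)),
   and symmetrically for rcompress, rexpand with V and V^H; t lists the modes
   already truncated in X, respectively still truncated in the result. *)
Fixpoint lcompress (t : seq 'I_N) (s : seq 'I_m) (X : qtensor R (dims t)) :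
    qtensor R (dims (map lmode s ++ t)) :=
  if s is i :: s' then
    @lmodeprod R N _ (dims (lmode i :: map lmode s' ++ t)) (lmode i)
      (hadj (castU (map lmode s' ++ t) i)) (lcompress s' X)
  else X.

Fixpoint rcompress (t : seq 'I_N) (s : seq 'I_m) (X : qtensor R (dims t)) :
    qtensor R (dims (map rmode s ++ t)) :=
  if s is j :: s' then
    @rmodeprod R N _ (dims (rmode j :: map rmode s' ++ t)) (rmode j)
      (rcompress s' X) (castV (map rmode s' ++ t) j)
  else X.

Fixpoint lexpand (t : seq 'I_N) (s : seq 'I_m) :
    qtensor R (dims (map lmode s ++ t)) -> qtensor R (dims t) :=
  if s is i :: s' then fun X =>
    lexpand (@lmodeprod R N (dims (lmode i :: map lmode s' ++ t))
      (dims (map lmode s' ++ t)) (lmode i) (castU (map lmode s' ++ t) i) X)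
  else id.

Fixpoint rexpand (t : seq 'I_N) (s : seq 'I_m) :
    qtensor R (dims (map rmode s ++ t)) -> qtensor R (dims t) :=
  if s is j :: s' then fun X =>
    rexpand (@rmodeprod R N (dims (rmode j :: map rmode s' ++ t))
      (dims (map rmode s' ++ t)) (rmode j) X (hadj (castV (map rmode s' ++ t) j)))
  else id.

Variable T : qtensor R I.

(* The modes greater than i, smallest first; the modes m + l with l < j,
   largest first. In both, the last mode to be truncated comes first. *)
Definition after (i : 'I_m) : seq 'I_m := [seq l : 'I_m <- enum 'I_m | (i < l)%N].
Definition before (j : 'I_m) : seq 'I_m :=
  rev [seq l : 'I_m <- enum 'I_m | (l < j)%N].

(* The tensors whose unfoldings determine U i and V j: in 1-based numbering,
   \hat L_{i+1} for the mode i and \hat R_{j-1} for the mode j. *)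
Definition Lhat_next (i : 'I_m) :
    qtensor R (dims (map lmode (after i) ++ [::])) :=
  @lcompress [::] (after i) T.
Definition Rhat_prev (j : 'I_m) :
    qtensor R (dims (map rmode (before j) ++ [::])) :=
  @rcompress [::] (before j) T.

Definition core : qtensor R (dims (map lmode (enum 'I_m) ++
                                   (map rmode (rev (enum 'I_m)) ++ [::]))) :=
  lcompress (enum 'I_m) (@rcompress [::] (rev (enum 'I_m)) T).

(* \hat T *)
Definition reconstruction : qtensor R I :=
  @rexpand [::] (rev (enum 'I_m)) (lexpand core).

Definition TS_QHOSVD_factors : Prop :=
  (forall i : 'I_m, leading_lsv (unfoldL (lmode i) (Lhat_next i))
                                (castU (map lmode (after i) ++ [::]) i)) /\
  (forall j : 'I_m, leading_rsv (unfoldR (rmode j) (Rhat_prev j))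
                                (castV (map rmode (before j) ++ [::]) j)).

Definition truncated_TS_QHOSVD (That : qtensor R I) : Prop :=
  TS_QHOSVD_factors /\ That = reconstruction.

End TSQHOSVD.

(* Main.v *)
(* For the real inner product Re(p qbar), the left mode product by W^H has the
   left mode product by W as adjoint, and W^H W = 1 for a factor W of the
   procedure. Hence, if C is a chain of compressions and E the reverse chain of
   expansions, E is adjoint to C, CE = 1, and |X - E(Z)|^2 =
   |X|^2 - |CX|^2 + |CX - Z|^2. The left and right modes are disjoint and left
   multiplications commute with right ones, so the reconstruction is
   E_L C_L (E_R C_R T), whence
     |T - That|^2 <= (|T|^2 - |C_L T|^2) + (|T|^2 - |C_R T|^2).
   Both terms telescope along their chains, and the loss at each step is a tail
   of squared singular values of the unfolding compressed at that step. *)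
Require Import Defs.
From mathcomp Require Import all_boot all_order all_algebra.
From mathcomp Require Import reals ring.

Set Implicit Arguments.
Unset Strict Implicit.
Unset Printing Implicit Defensive.

Import Order.TTheory GRing.Theory Num.Theory.
Local Open Scope ring_scope.

(** * Orthogonality relations for a coisometry [C] and its adjoint [E] *)

Section InnerProduct.
Variable R : realType.

Definition inner_product (V : zmodType) (dot : V -> V -> R) : Prop :=
  [/\ forall x y z, dot (x - y) z = dot x z - dot y z,
      forall x y, dot x y = dot y x & forall x, 0 <= dot x x].

Variables (V W : zmodType) (dotV : V -> V -> R) (dotW : W -> W -> R).
Hypotheses (ipV : inner_product dotV) (ipW : inner_product dotW).
Variables (C : V -> W) (E : W -> V).
Hypothesis adjCE : forall x y, dotW (C x) y = dotV x (E y).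
Hypothesis CK : cancel E C.

(** Expand both squares: adjointness turns <x, E y> into <C x, y>, and [CK] gives |E y|^2 = <C (E
    y), y> = |y|^2. *)
Lemma coisometry_pythagoras x y :
  dotV (x - E y) (x - E y) =
  dotV x x - dotW (C x) (C x) + dotW (C x - y) (C x - y).
Proof.
have [BV symV _] := ipV; have [BW symW _] := ipW.
rewrite BV BW (symV x) (symV (E y)) (symW (C x)) (symW y) !BV !BW.
rewrite (symV (E y) x) -!adjCE CK (symW y (C x)).
by ring.
Qed.

Lemma coisometry_gap x :
  dotV (x - E (C x)) (x - E (C x)) = dotV x x - dotW (C x) (C x).
Proof.
have [BW _ _] := ipW.
(* Writing one argument of [dotW 0 0] as 0 - 0 shows by subtractivity that this term vanishes. *)
by rewrite coisometry_pythagoras subrr -{1}(subrr 0) BW subrr addr0.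
Qed.

Lemma coisometry_contracts x : dotW (C x) (C x) <= dotV x x.
Proof. by have [_ _ ge0] := ipV; rewrite -subr_ge0 -coisometry_gap. Qed.

End InnerProduct.

(** * Quaternion conjugation and the real inner product Re(x conj(y)) *)

Section Quaternion.
Variable R : realType.
Local Notation H := (quat R).
Implicit Types x y z u : H.

Lemma qconjD : {morph @qconj R : x y / x + y}.
Proof.
by move=> x y; congr Quat; rewrite /= ?opprD.
Qed.

Lemma qconj0 : qconj 0 = 0 :> H.
Proof. by congr Quat; rewrite oppr0. Qed.

Lemma qconjK : involutive (@qconj R).
Proof. by case=> a b c d; rewrite /qconj /= !opprK. Qed.

Lemma qconjM x y : qconj (x * y) = qconj y * qconj x.
Proof. by congr Quat; rewrite /=; ring. Qed.

Lemma qconj_real (a : R) : qconj (qreal a) = qreal a.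
Proof. by congr Quat; rewrite /= oppr0. Qed.

Lemma qrealM (a b : R) : qreal a * qreal b = qreal (a * b).
Proof. by congr Quat; rewrite /=; ring. Qed.

Lemma qconj_sum (J : Type) (r : seq J) (P : pred J) (F : J -> H) :
  qconj (\sum_(i <- r | P i) F i) = \sum_(i <- r | P i) qconj (F i).
Proof. exact: (big_morph (@qconj R) qconjD qconj0). Qed.

Lemma qre_sum (J : Type) (r : seq J) (P : pred J) (F : J -> H) :
  qre (\sum_(i <- r | P i) F i) = \sum_(i <- r | P i) qre (F i).
Proof. exact: (big_morph (@qre R)). Qed.

Definition qdot x y : R := qre (x * qconj y).

Lemma qdotC x y : qdot x y = qdot y x.
Proof. by rewrite /qdot /=; ring. Qed.

Lemma qdotBl x y z : qdot (x - y) z = qdot x z - qdot y z.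
Proof. by rewrite /qdot mulrBl. Qed.

Lemma qdot_ge0 x : 0 <= qdot x x.
Proof. by rewrite /qdot mulq_conj /= !addr_ge0 ?sqr_ge0. Qed.

Lemma qabs_sqr x : qabs x ^+ 2 = qdot x x.
Proof. by rewrite sqr_sqrtr ?qdot_ge0. Qed.

Lemma qdot_conj x y : qdot (qconj x) (qconj y) = qdot x y.
Proof. by rewrite /qdot /=; ring. Qed.

(** The real part is invariant under cyclic permutation of a product: Re(u x conj(y)) = Re(x conj(y)
    u), and conj(y) u is the conjugate of conj(u) y. *)
Lemma qdot_adj u x y : qdot (u * x) y = qdot x (qconj u * y).
Proof. by rewrite /qdot /=; ring. Qed.

Lemma qdot_real u (a : R) : qre (u * qreal a * qconj u) = qdot u u * a.
Proof. by rewrite /qdot /=; ring. Qed.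

Lemma qdot_suml (J : Type) (r : seq J) (P : pred J) (F : J -> H) y :
  qdot (\sum_(i <- r | P i) F i) y = \sum_(i <- r | P i) qdot (F i) y.
Proof. by rewrite /qdot mulr_suml qre_sum. Qed.

Lemma qdot_sumr (J : Type) (r : seq J) (P : pred J) (F : J -> H) y :
  qdot y (\sum_(i <- r | P i) F i) = \sum_(i <- r | P i) qdot y (F i).
Proof. by rewrite qdotC qdot_suml; apply: eq_bigr => i _; rewrite qdotC. Qed.

End Quaternion.

(** * Quaternion matrices: adjoints, Gram matrices, and the norm lost by truncating an SVD *)

Section QuatMatrixTheory.
Variable R : realType.
Local Notation H := (quat R).

Lemma hadjE p q (A : 'M[H]_(p, q)) i j : hadj A i j = qconj (A j i).
Proof. by rewrite !mxE. Qed.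

Lemma hadjK p q (A : 'M[H]_(p, q)) : hadj (hadj A) = A.
Proof. by apply/matrixP => i j; rewrite !hadjE qconjK. Qed.

Lemma hadjM p q r (A : 'M[H]_(p, q)) (B : 'M[H]_(q, r)) :
  hadj (A *m B) = hadj B *m hadj A.
Proof.
apply/matrixP => i j; rewrite hadjE !mxE qconj_sum.
by apply: eq_bigr => k _; rewrite !hadjE qconjM.
Qed.

Definition mdot p q (A B : 'M[H]_(p, q)) : R :=
  \sum_i \sum_j qdot (A i j) (B i j).

Lemma mdot_inner p q : inner_product (@mdot p q).
Proof.
split=> [A B C|A B|A].
- rewrite /mdot -sumrB; apply: eq_bigr => i _; rewrite -sumrB.
  by apply: eq_bigr => j _; rewrite !mxE qdotBl.
- by do 2![apply: eq_bigr => ? _]; rewrite qdotC.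
- by do 2![apply: sumr_ge0 => ? _]; apply: qdot_ge0.
Qed.

Lemma mdot_adj p q r (A : 'M[H]_(p, q)) (X : 'M[H]_(q, r)) Y :
  mdot (A *m X) Y = mdot X (hadj A *m Y).
Proof.
rewrite /mdot exchange_big [RHS]exchange_big; apply: eq_bigr => j _ /=.
under eq_bigr => i _ do rewrite mxE qdot_suml.
rewrite exchange_big; apply: eq_bigr => k _ /=.
rewrite mxE qdot_sumr; apply: eq_bigr => i _.
by rewrite qdot_adj hadjE.
Qed.

Lemma mdot_rows p q (A : 'M[H]_(p, q)) :
  mdot A A = \sum_i qre ((A *m hadj A) i i).
Proof.
apply: eq_bigr => i _; rewrite mxE qre_sum.
by apply: eq_bigr => j _; rewrite hadjE.
Qed.

Definition diag_sqr (s : nat -> R) p : 'M[H]_p :=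
  \matrix_(i, j) if i == j then qreal (s i ^+ 2) else 0.

(** Right singular vectors of [M] become left singular vectors of its adjoint; the right modes are
    reduced to the left ones this way. *)
Lemma is_qsvd_hadj p q (M : 'M[H]_(p, q)) U s V :
  is_qsvd M U s V -> is_qsvd (hadj M) V s U.
Proof.
case=> -[uU uV] s_ge0 s_dec s0 ->; split=> //; first by rewrite minnC.
rewrite hadjM hadjK hadjM mulmxA.
set S := (X in V *m X *m _ = _); set S' := (X in _ = V *m X *m _).
suff -> : S = S' by []; rewrite {}/S {}/S'.
apply/matrixP => i j; rewrite hadjE !mxE eq_sym.
by case: eqP => [->|_]; rewrite ?qconj_real ?qconj0.
Qed.

Lemma qsvd_gram p q (M : 'M[H]_(p, q)) U s V :
  is_qsvd M U s V -> M *m hadj M = U *m diag_sqr s p *m hadj U.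
Proof.
case=> -[uU uV] s_ge0 s_dec s0 ->; set S := (\matrix_(i, j) _).
rewrite !hadjM hadjK -!mulmxA; congr (_ *m _).
rewrite (mulmxA (hadj V)) uV mul1mx !mulmxA; congr (_ *m _).
apply/matrixP => i j; rewrite !mxE.
(* A row index beyond the [q] columns meets no diagonal entry; there [s i] is zero by convention, so
   [diag_sqr] agrees. *)
have [lt_iq|le_qi] := ltnP i q; last first.
  rewrite big1 => [|k _]; last first.
    by rewrite mxE gtn_eqF ?mul0r // (leq_trans (ltn_ord k)).
  by rewrite s0 ?expr0n ?if_same // geq_min le_qi orbT.
rewrite (bigD1 (Ordinal lt_iq)) //= big1 ?addr0 => [|k neq_ki]; last first.
  rewrite mxE; case: eqP => [eq_ik|_]; last by rewrite mul0r.
  by case/eqP: neq_ki; apply: val_inj.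
rewrite hadjE !mxE eqxx /= eq_sym (inj_eq val_inj).
case: eqP => [->|_]; last by rewrite qconj0 mulr0.
by rewrite qconj_real qrealM expr2.
Qed.

(** Column [k] of [W] is a unit vector, and [hadj U] contracts because it is a coisometry with
    adjoint [U]. *)
Lemma bessel_col p q r (U : 'M[H]_(p, q)) (W : 'M[H]_(p, r)) k :
  hadj U *m U = 1%:M -> hadj W *m W = 1%:M ->
  \sum_i qdot ((hadj U *m W) i k) ((hadj U *m W) i k) <= 1.
Proof.
move=> uU uW.
have adj x y : mdot (hadj U *m x) y = mdot x (U *m y) :> R.
  by move=> *; rewrite mdot_adj hadjK.
have := @coisometry_contracts _ _ _ _ _ (mdot_inner _ _) (mdot_inner _ _)
  (mulmx (hadj U)) (mulmx U) (@adj 1%N) _ (col k W).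
have -> : mdot (col k W) (col k W) = 1.
  have -> : 1 = qre ((hadj W *m W) k k) by rewrite uW mxE eqxx.
  rewrite mxE qre_sum; apply: eq_bigr => i _.
  by rewrite big_ord1 !mxE -qdot_conj /qdot qconjK.
move=> le1; apply: le_trans (le1 _).
  rewrite le_eqVlt; apply/orP; left; apply/eqP.
  apply: eq_bigr => i _; rewrite big_ord1.
  suff -> : (hadj U *m col k W) i 0 = (hadj U *m W) i k by [].
  by rewrite !mxE; apply: eq_bigr => l _; rewrite !mxE.
by move=> y; rewrite mulmxA uU mul1mx.
Qed.

(** Exchanging the sums gives each [b k] a weight [c k] in [0, 1], of total at most [r]. Such
    weights do best when concentrated on the [r] largest values. *)
Lemma substochastic_partial_sum p r (w : 'I_p -> 'I_p -> R) (a b : nat -> R) :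
  (r <= p)%N -> (forall i k, 0 <= w i k) ->
  (forall i, \sum_k w i k <= 1) -> (forall k, \sum_i w i k <= 1) ->
  (forall k l, (k <= l)%N -> b l <= b k) -> (forall k, 0 <= b k) ->
  (forall i : 'I_p, a i = \sum_k w i k * b k) ->
  \sum_(i < p | (i < r)%N) a i <= \sum_(i < p | (i < r)%N) b i.
Proof.
move=> le_rp w_ge0 row1 col1 b_dec b_ge0 aE.
under eq_bigr => i _ do rewrite aE.
rewrite exchange_big /=.
pose c k := \sum_(i < p | (i < r)%N) w i k.
have c_ge0 k : 0 <= c k by apply: sumr_ge0.
have c_le1 k : c k <= 1.
  apply: le_trans (col1 k); rewrite [leRHS](bigID (fun i : 'I_p => (i < r)%N)) /=.
  by rewrite lerDl sumr_ge0.
have sum_c : \sum_k c k <= r%:R.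
  rewrite exchange_big /=; apply: (@le_trans _ _ (\sum_(i < p | (i < r)%N) 1)).
    exact: ler_sum.
  by rewrite -(big_ord_widen _ (fun=> 1)) // sumr_const card_ord.
(* Values are measured from the threshold [b r], which exists even for [r = p] since [b] is a
   sequence. Indices below [r] then contribute at most [b k - b r], later ones at most 0. *)
have -> : \sum_(k < p) \sum_(i < p | (i < r)%N) w i k * b k =
    \sum_k c k * (b k - b r) + (\sum_k c k) * b r.
  rewrite mulr_suml -big_split; apply: eq_bigr => k _ /=.
  by rewrite -mulrDr subrK mulr_suml.
have -> : \sum_(k < p | (k < r)%N) b k =
    \sum_(k < p | (k < r)%N) (b k - b r) + r%:R * b r.
  rewrite sumrB -[X in _ = _ - X + _](big_ord_widen _ (fun=> b r)) //.
  by rewrite sumr_const card_ord mulr_natl subrK.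
apply: lerD; last exact: ler_wpM2r.
rewrite (bigID (fun k : 'I_p => (k < r)%N)) /= -[leRHS]addr0; apply: lerD.
  apply: ler_sum => k lt_kr; rewrite ler_piMl // subr_ge0; apply: b_dec.
  exact: ltnW.
apply: sumr_le0 => k; rewrite -leqNgt => le_rk.
by rewrite mulr_ge0_le0 // subr_le0 b_dec.
Qed.

(* With Z = U^H U', the weights |Z_ik|^2 express s_i^2 in terms of the s'_k^2,
   and are doubly substochastic by Bessel's inequality.
   The truncation bound then compares two possibly different SVDs of M. *)
Lemma qsvd_partial_sum p q (M : 'M[H]_(p, q)) U s V U' s' V' r :
  (r <= p)%N -> is_qsvd M U s V -> is_qsvd M U' s' V' ->
  \sum_(i < p | (i < r)%N) s i ^+ 2 <= \sum_(i < p | (i < r)%N) s' i ^+ 2.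
Proof.
move=> le_rp svd svd'; have [[uU _] _ _ _ _] := svd.
have [[uU' _] s'_ge0 s'_dec _ _] := svd'.
pose Z := hadj U *m U'; pose w i k := qdot (Z i k) (Z i k).
apply: (@substochastic_partial_sum _ _ w (fun i => s i ^+ 2)
  (fun i => s' i ^+ 2)) => //.
- by move=> i k; apply: qdot_ge0.
(* Row [i] of [Z] is, up to conjugation, column [i] of [hadj U' *m U], so Bessel applies to rows
   too. *)
- move=> i; rewrite (eq_bigr (fun k =>
      qdot ((hadj U' *m U) k i) ((hadj U' *m U) k i))) => [|k _].
    exact: bessel_col.
  have -> : hadj U' *m U = hadj Z by rewrite hadjM hadjK.
  by rewrite hadjE qdot_conj.
- by move=> k; apply: bessel_col.
- by move=> k l /s'_dec; apply: lerXn2r; rewrite ?nnegrE.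
- by move=> k; rewrite sqr_ge0.
(* Both SVDs diagonalise the same matrix [M *m hadj M]; the diagonal entries of the change of basis
   give the weights. *)
move=> i; have eqD : diag_sqr s p = Z *m diag_sqr s' p *m hadj Z.
  rewrite /Z hadjM hadjK -!mulmxA (mulmxA U') (mulmxA (U' *m _)).
  by rewrite -(qsvd_gram svd') (qsvd_gram svd) -!mulmxA uU mulmx1 mulmxA uU mul1mx.
have -> : s i ^+ 2 = qre (diag_sqr s p i i) by rewrite mxE eqxx.
rewrite eqD mxE qre_sum; apply: eq_bigr => k _.
rewrite hadjE -qdot_real mxE (bigD1 k) //= [diag_sqr _ _ k k]mxE eqxx.
rewrite big1 ?addr0 // => l neq_lk.
by rewrite [diag_sqr _ _ _ _]mxE (negbTE neq_lk) mulr0.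
Qed.

Lemma leading_cols_iso p r (W : 'M[H]_(p, r)) U :
  (r <= p)%N -> qunitary U -> leading_cols W U -> hadj W *m W = 1%:M.
Proof.
move=> le_rp uU WU; apply/matrixP => i j; pose wid := widen_ord le_rp.
have -> : 1%:M i j = (hadj U *m U) (wid i) (wid j).
  by rewrite uU !mxE -!(inj_eq val_inj).
rewrite !mxE; apply: eq_bigr => k _.
by rewrite !hadjE (WU k i (wid i)) // (WU k j (wid j)).
Qed.

Lemma leading_lsv_iso p q r (M : 'M[H]_(p, q)) (W : 'M[H]_(p, r)) :
  leading_lsv M W -> hadj W *m W = 1%:M.
Proof.
by case=> le_rp [U [s [V [[[uU _] _ _ _ _] WU]]]]; apply: leading_cols_iso uU WU.
Qed.

(** In any SVD, row [i] of [hadj U *m M] has squared norm the square of the [i]-th singular value.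
    The values [s'] behind [W] need not come from the same SVD as [s], so the partial sums up to [r]
    are compared by [qsvd_partial_sum]. *)
Lemma leading_lsv_gap p q r (M : 'M[H]_(p, q)) (W : 'M[H]_(p, r)) s :
  leading_lsv M W -> singular_values M s ->
  mdot M M - mdot (hadj W *m M) (hadj W *m M) <= \sum_(r <= k < p) s k ^+ 2.
Proof.
move=> [le_rp [U' [s' [V' [svd' WU']]]]] [U [V svd]].
have [[uU _] _ _ _ _] := svd; have [[uU' _] _ _ _ _] := svd'.
have gram_diag U0 s0 V0 : is_qsvd M U0 s0 V0 -> forall i,
    qre (((hadj U0 *m M) *m hadj (hadj U0 *m M)) i i) = s0 i ^+ 2.
  move=> svd0 i; have [[uU0 _] _ _ _ _] := svd0.
  rewrite hadjM hadjK -!mulmxA (mulmxA M) (qsvd_gram svd0) -!mulmxA uU0 mulmx1.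
  by rewrite mulmxA uU0 mul1mx mxE eqxx.
have -> : mdot M M = \sum_(i < p) s i ^+ 2.
  (* Writing M = U X lets [hadj U *m U = 1%:M] alone show that both norms equal that of X. *)
  have -> : mdot M M = mdot (hadj U *m M) (hadj U *m M).
    have [_ _ _ _ ->] := svd; rewrite -mulmxA; set X := (X in U *m X).
    by rewrite mdot_adj [hadj U *m _]mulmxA uU mul1mx.
  by rewrite mdot_rows; apply: eq_bigr => i _; apply: gram_diag svd i.
have -> : mdot (hadj W *m M) (hadj W *m M) =
    \sum_(i < p | (i < r)%N) s' i ^+ 2.
  rewrite -(big_ord_widen _ (fun i => s' i ^+ 2)) // mdot_rows.
  apply: eq_bigr => i _; rewrite -(gram_diag _ _ _ svd' (widen_ord le_rp i)).
  rewrite !mxE; congr qre; apply: eq_bigr => j _; rewrite !hadjE.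
  suff -> : (hadj W *m M) i j = (hadj U' *m M) (widen_ord le_rp i) j by [].
  rewrite !mxE; apply: eq_bigr => l _.
  by rewrite !hadjE (WU' l i (widen_ord le_rp i)).
rewrite lerBlDr; have le_s := qsvd_partial_sum le_rp svd svd'.
rewrite (bigID (fun i : 'I_p => (i < r)%N)) /= addrC.
apply: lerD => //; rewrite le_eqVlt; apply/orP; left; apply/eqP.
rewrite -(big_mkord (fun i => ~~ (i < r)%N) (fun i => s i ^+ 2)).
rewrite (@big_cat_nat _ _ _ r) //= big_nat_cond big1 ?add0r => [|i]; last first.
  by case/andP=> /andP[_ ->].
rewrite big_nat_cond [RHS]big_nat_cond; apply: eq_bigl => i.
by rewrite -leqNgt; case: (r <= i)%N; rewrite ?andbF ?andbT.
Qed.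

End QuatMatrixTheory.

(** * Multi-indices that differ in one mode only *)

Section MultiIndex.
Variable N : nat.
Implicit Types (d : 'I_N -> nat) (k l : 'I_N).

Definition same_off k d d' : Prop := forall l, l != k -> d l = d' l.

Lemma same_off_sym k d d' : same_off k d d' -> same_off k d' d.
Proof. by move=> E l /E. Qed.

Lemma agree_offP k d d' (a : mindex d) (b : mindex d') :
  reflect (forall l, l != k -> a l = b l :> nat) (agree_off k a b).
Proof.
by apply: (iffP forallP) => E l; apply/implyP || move/(implyP (E l))/eqP;
  rewrite // => /E->.
Qed.

Lemma agree_off_sym k d d' (a : mindex d) (b : mindex d') :
  agree_off k a b = agree_off k b a.
Proof.
by apply: eq_forallb => l; rewrite (eq_sym (a l : nat)).
Qed.

Lemma mindex_eq d (a b : mindex d) : (forall l, a l = b l :> nat) -> a = b.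
Proof. by move=> E; apply/ffunP => l; apply: val_inj; apply: E. Qed.

Lemma mindex_exists d (f : 'I_N -> nat) :
  (forall l, (f l < d l)%N) -> exists a : mindex d, forall l, a l = f l :> nat.
Proof. by move=> lt_f; exists [ffun l => Ordinal (lt_f l)] => l; rewrite ffunE. Qed.

Fact set_mode_subproof k d d' (a : mindex d') (i : 'I_(d k)) :
  same_off k d' d -> forall l, ((if l == k then i : nat else a l) < d l)%N.
Proof. by move=> E l; case: eqVneq => [-> //|/E <-]. Qed.

(** The dimensions off [k] are equal but not convertible, so every coordinate is rebuilt as an
    ordinal of the same value. *)
Definition set_mode k d d' (a : mindex d') (E : same_off k d' d) (i : 'I_(d k)) :
    mindex d :=
  [ffun l => Ordinal (set_mode_subproof a i E l)].

Lemma set_modeE k d d' (a : mindex d') (E : same_off k d' d) i l :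
  set_mode a E i l = (if l == k then i : nat else a l) :> nat.
Proof. by rewrite ffunE. Qed.

Lemma set_mode_id k d d' (a : mindex d') (E : same_off k d' d) i :
  set_mode a E i k = i.
Proof. by apply: val_inj; rewrite /= set_modeE eqxx. Qed.

Lemma set_mode_agree k d d' (a : mindex d') (E : same_off k d' d) i :
  agree_off k a (set_mode a E i).
Proof. by apply/agree_offP => l /negbTE neq_lk; rewrite set_modeE neq_lk. Qed.

(** This turns the sums defining mode products into sums over one contracted index, as in a matrix
    product. *)
Lemma big_agree_off (V : nmodType) k d d' (a : mindex d')
    (E : same_off k d' d) (F : mindex d -> V) :
  \sum_(b | agree_off k a b) F b = \sum_i F (set_mode a E i).
Proof.
rewrite (reindex (set_mode a E)) /=.
  by apply: eq_bigl => i; rewrite set_mode_agree.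
exists (fun b => b k) => [i _|b /agree_offP ab]; first exact: set_mode_id.
by apply: mindex_eq => l; rewrite set_modeE; case: eqVneq => [->|/ab ->].
Qed.

(* At most one b is counted: it takes its mode k from c and all others from a. *)
Lemma big_agree_off2 (V : nmodType) k k' d d1 d2 (a : mindex d1) (c : mindex d2)
    (x : V) :
  k != k' -> same_off k d1 d -> same_off k' d2 d ->
  \sum_(b : mindex d | agree_off k a b && agree_off k' b c) x =
  if [forall l, (l != k) && (l != k') ==> (a l == c l :> nat)] then x else 0.
Proof.
move=> neq_k E1 E2; case: forallP => [ac|nac]; last first.
  rewrite big1 // => b /andP[/agree_offP ab /agree_offP bc]; case: nac => l.
  by apply/implyP => /andP[lk lk']; rewrite ab // bc.
have [|b bE] := @mindex_exists d (fun l => if l == k then c l : nat else a l).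
  move=> l; case: eqVneq => [-> |/E1 <- //].
  by rewrite -(E2 k).
rewrite (big_pred1 b) // => b'; apply/andP/eqP => [[/agree_offP ab /agree_offP bc]|->].
  apply: mindex_eq => l; rewrite bE.
  by case: eqVneq => [->|/ab <- //]; rewrite bc.
split; apply/agree_offP => l.
  by move/negbTE=> lk; rewrite bE lk.
move=> lk'; rewrite bE; case: eqVneq => // lk.
by apply/eqP; have := ac l; rewrite lk lk'.
Qed.

(** Neither the digits nor the weights of the column index involve mode [k]. *)
Lemma colidx_agree_off k d d' (a : mindex d) (b : mindex d') :
  same_off k d d' -> agree_off k a b -> colidx k a = colidx k b.
Proof.
move=> E /agree_offP ab; apply: eq_bigr => l lk; rewrite ab //; congr (_ * _)%N.
by apply: eq_bigr => s /andP[_ sk]; rewrite E.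
Qed.

End MultiIndex.

(** * Mode products: adjoints, composition, and commutation of left with right *)

Section TensorTheory.
Variables (R : realType) (N : nat).
Local Notation H := (quat R).
Implicit Types (d : 'I_N -> nat) (k : 'I_N).

Definition tdot d (X Y : qtensor R d) : R := \sum_a qdot (X a) (Y a).

Lemma tdot_inner d : inner_product (@tdot d).
Proof.
split=> [X Y Z|X Y|X].
- by rewrite /tdot -sumrB; apply: eq_bigr => a _; rewrite !ffunE qdotBl.
- by apply: eq_bigr => a _; rewrite qdotC.
- by apply: sumr_ge0 => a _; apply: qdot_ge0.
Qed.

Lemma frob_sqr d (X : qtensor R d) : frob X ^+ 2 = tdot X X.
Proof.
rewrite sqr_sqrtr; last by apply: sumr_ge0 => a _; rewrite sqr_ge0.
by apply: eq_bigr => a _; rewrite qabs_sqr.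
Qed.

Lemma lmodeprod_adj d d' k (A : 'M[H]_(d' k, d k)) (X : qtensor R d)
    (Y : qtensor R d') :
  tdot (lmodeprod A X) Y = tdot X (lmodeprod (hadj A) Y).
Proof.
rewrite /tdot.
under eq_bigr => a _ do rewrite ffunE qdot_suml.
under [RHS]eq_bigr => a _ do rewrite ffunE qdot_sumr.
rewrite (exchange_big_dep predT) //=; apply: eq_bigr => b _.
apply: eq_big => [a|a _]; first by rewrite agree_off_sym.
by rewrite qdot_adj hadjE.
Qed.

Lemma lmodeprodB d d' k (A : 'M[H]_(d' k, d k)) (X Y : qtensor R d) :
  lmodeprod A (X - Y : qtensor R d) = lmodeprod A X - lmodeprod A Y
  :> qtensor R d'.
Proof.
apply/ffunP => a; rewrite !ffunE -sumrB.
by apply: eq_bigr => b _; rewrite !ffunE mulrBr.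
Qed.

Lemma lmodeprod_comp d d' d'' k (A : 'M[H]_(d'' k, d' k))
    (B : 'M[H]_(d' k, d k)) (X : qtensor R d) :
  same_off k d'' d' -> same_off k d' d ->
  lmodeprod A (lmodeprod B X : qtensor R d') = lmodeprod (A *m B) X
  :> qtensor R d''.
Proof.
move=> E1 E2; have E3 : same_off k d'' d by move=> l lk; rewrite E1 ?E2.
apply/ffunP => a; rewrite !ffunE (big_agree_off _ E1) (big_agree_off _ E3).
under [RHS]eq_bigr => j _ do rewrite mxE mulr_suml.
rewrite exchange_big; apply: eq_bigr => i _ /=.
rewrite [lmodeprod B X _]ffunE (big_agree_off _ E2) mulr_sumr; apply: eq_bigr => j _.
rewrite !set_mode_id mulrA; congr (_ * X _); apply: mindex_eq => l.
by rewrite !set_modeE; case: ifP => // ->.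
Qed.

Lemma lmodeprod1 d k (X : qtensor R d) : lmodeprod (1%:M : 'M_(d k)) X = X.
Proof.
apply/ffunP => a; rewrite ffunE (bigD1 a) /=; last by apply/agree_offP.
rewrite mxE eqxx mul1r big1 ?addr0 // => b /andP[/agree_offP ab neq_ba].
rewrite mxE; case: eqP => [eqk|_]; last by rewrite mul0r.
case/eqP: neq_ba; apply: mindex_eq => l.
by case: (eqVneq l k) => [->|/ab //]; rewrite eqk.
Qed.

Lemma lmodeprodK d d' k (A : 'M[H]_(d k, d' k)) :
  same_off k d d' -> hadj A *m A = 1%:M ->
  cancel (fun X : qtensor R d' => lmodeprod A X : qtensor R d)
         (fun X => lmodeprod (hadj A) X).
Proof.
move=> E AA X; rewrite lmodeprod_comp ?AA ?lmodeprod1 //.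
exact: same_off_sym.
Qed.

Definition tconj d (X : qtensor R d) : qtensor R d := [ffun a => qconj (X a)].

Lemma tconjK d : involutive (@tconj d).
Proof. by move=> X; apply/ffunP => a; rewrite !ffunE qconjK. Qed.

Lemma tdot_conj d (X Y : qtensor R d) : tdot (tconj X) (tconj Y) = tdot X Y.
Proof. by apply: eq_bigr => a _; rewrite !ffunE qdot_conj. Qed.

(** Conjugation reverses products and so exchanges the two sides; facts on right mode products are
    transported from left ones along this identity. *)
Lemma rmodeprodE d d' k (X : qtensor R d) (B : 'M[H]_(d k, d' k)) :
  rmodeprod X B = tconj (lmodeprod (hadj B) (tconj X)) :> qtensor R d'.
Proof.
apply/ffunP => a; rewrite !ffunE qconj_sum; apply: eq_bigr => b _.
by rewrite ffunE hadjE qconjM !qconjK.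
Qed.

Lemma rmodeprod_adj d d' k (B : 'M[H]_(d k, d' k)) (X : qtensor R d)
    (Y : qtensor R d') :
  tdot (rmodeprod X B) Y = tdot X (rmodeprod Y (hadj B)).
Proof.
by rewrite !rmodeprodE -tdot_conj tconjK lmodeprod_adj -tdot_conj tconjK.
Qed.

Lemma rmodeprodK d d' k (B : 'M[H]_(d k, d' k)) :
  same_off k d d' -> hadj B *m B = 1%:M ->
  cancel (fun X : qtensor R d' => rmodeprod X (hadj B) : qtensor R d)
         (fun X => rmodeprod X B).
Proof.
by move=> E BB X; rewrite !rmodeprodE tconjK hadjK lmodeprodK // tconjK.
Qed.

(* Commuting two mode products changes the dimensions of both factors in a way
   that is only propositionally the identity; entries indexed by nat, with junk
   value 0 out of range, compare matrices across such dimensions. *)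
Definition mx_entry p q (A : 'M[H]_(p, q)) (x y : nat) : H :=
  if insub x is Some i then if insub y is Some j then A i j else 0 else 0.

Lemma mx_entryE p q (A : 'M[H]_(p, q)) i j : A i j = mx_entry A i j.
Proof. by rewrite /mx_entry !valK. Qed.

Lemma mx_entry_hadj p q (A : 'M[H]_(p, q)) x y :
  mx_entry (hadj A) x y = qconj (mx_entry A y x).
Proof.
rewrite /mx_entry; case: insubP => [i _ _|_]; case: insubP => [j _ _|_];
  by rewrite ?hadjE ?qconj0.
Qed.

Lemma mx_entry_conform p q p' q' m n (A : 'M[H]_(m, n)) :
  p = p' -> q = q' ->
  mx_entry (conform_mx (0 : 'M_(p, q)) A) =2
  mx_entry (conform_mx (0 : 'M_(p', q')) A).
Proof. by move=> -> ->. Qed.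

Lemma mx_entry_conform_id p q p' q' (A : 'M[H]_(p, q)) :
  p = p' -> q = q' -> mx_entry (conform_mx (0 : 'M_(p', q')) A) =2 mx_entry A.
Proof. by move=> <- <-; rewrite conform_mx_id. Qed.

(** The two digits in [d00] to [d11] record whether mode [k], respectively [k'], has been changed.
    Both sides are double sums over an entry [c] of [X] and an intermediate multi-index [b], which
    [c] and the output index determine. *)
Lemma lmodeprod_rmodeprod d00 d01 d10 d11 k k' (X : qtensor R d00)
    (A : 'M[H]_(d11 k, d01 k)) (A' : 'M[H]_(d10 k, d00 k))
    (B : 'M[H]_(d00 k', d01 k')) (B' : 'M[H]_(d10 k', d11 k')) :
  k != k' ->
  same_off k d00 d10 -> same_off k d01 d11 ->
  same_off k' d00 d01 -> same_off k' d10 d11 ->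
  mx_entry A =2 mx_entry A' -> mx_entry B =2 mx_entry B' ->
  lmodeprod A (rmodeprod X B : qtensor R d01) =
  rmodeprod (lmodeprod A' X : qtensor R d10) B' :> qtensor R d11.
Proof.
move=> neq_k E1 E2 E3 E4 eqA eqB; apply/ffunP => a; rewrite !ffunE.
(* In either order [b] shares one of the modes [k], [k'] with [c] and the other with [a], so the
   summand depends only on [a] and [c]. *)
pose F (c : mindex d00) :=
  mx_entry A (a k) (c k) * X c * mx_entry B (c k') (a k').
transitivity (\sum_c \sum_(b : mindex d01 | agree_off k a b && agree_off k' b c) F c).
  rewrite (exchange_big_dep (agree_off k a)) /=; last by move=> c b _ /andP[].
  apply: eq_bigr => b ab; rewrite ffunE mulr_sumr.
  apply: eq_big => [c|c /agree_offP bc]; first by rewrite ab.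
  rewrite mulrA !mx_entryE /F.
  by rewrite -(bc k) // (agree_offP _ _ _ ab k') // eq_sym.
transitivity (\sum_c \sum_(b : mindex d10 | agree_off k' a b && agree_off k b c) F c).
  apply: eq_bigr => c _; rewrite !big_agree_off2 // 1?eq_sym //;
    try exact: same_off_sym.
  by under eq_forallb => l do rewrite andbC.
rewrite (exchange_big_dep (agree_off k' a)) /=; last by move=> c b _ /andP[].
apply: eq_bigr => b ab; rewrite ffunE mulr_suml.
apply: eq_big => [c|c]; rewrite ab //= => /agree_offP bc; rewrite !mx_entryE /F.
by rewrite -(bc k') 1?eq_sym // (agree_offP _ _ _ ab k) // eqA eqB.
Qed.

(** * Unfoldings, and the norm lost by truncating a single mode *)

Definition mode_pair d k (a : mindex d) :
    'I_(d k) * 'I_(\prod_(l | l != k) d l) :=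
  (a k, Ordinal (colidx_lt k a)).

Lemma mode_pair_bij d k : bijective (@mode_pair d k).
Proof.
have ex p : exists a : mindex d, mode_pair k a == p.
  case: p => i j; have [a [ai aj]] := mode_index_exists i (ltn_ord j).
  by exists a; apply/eqP; congr (_, _) => //; apply: val_inj.
exists (fun p => xchoose (ex p)) => [a|p].
  by have /eqP[/mode_index_inj inj /inj] := xchooseP (ex (mode_pair k a)).
exact/eqP/(xchooseP (ex p)).
Qed.

Lemma unfoldLE d k (X : qtensor R d) a (j : 'I_(\prod_(l | l != k) d l)) :
  colidx k a = j :> nat -> unfoldL k X (a k) j = X a.
Proof.
move=> aj; rewrite mxE; case: pickP => [b /andP[/eqP bk /eqP bj]|/(_ a)].
  by congr (X _); apply: (mode_index_inj bk); rewrite bj.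
by rewrite eqxx aj eqxx.
Qed.

Lemma mdot_unfoldL d k (X Y : qtensor R d) :
  mdot (unfoldL k X) (unfoldL k Y) = tdot X Y.
Proof.
rewrite /mdot pair_big (reindex (@mode_pair d k)) /=; last first.
  exact/onW_bij/mode_pair_bij.
by apply: eq_bigr => a _; rewrite !unfoldLE.
Qed.

(** A square [P] keeps the dimensions [d], so both unfoldings have the same column type and no cast
    appears. *)
Lemma unfoldL_lmodeprod d k (P : 'M[H]_(d k)) (X : qtensor R d) :
  unfoldL k (lmodeprod P X : qtensor R d) = P *m unfoldL k X.
Proof.
apply/matrixP => i j; have [a [<- aj]] := mode_index_exists i (ltn_ord j).
have E : same_off k d d by [].
rewrite unfoldLE // ffunE mxE (big_agree_off _ E); apply: eq_bigr => p _.
rewrite -(@unfoldLE d k X _ j) ?set_mode_id // -aj.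
exact/esym/(colidx_agree_off E)/set_mode_agree.
Qed.

Lemma lmodeprod_gap d d' k (X : qtensor R d) (W : 'M[H]_(d k, d' k)) s :
  same_off k d d' ->
  leading_lsv (unfoldL k X) W -> singular_values (unfoldL k X) s ->
  let Y : qtensor R d' := lmodeprod (hadj W) X in
  tdot X X - tdot Y Y <= \sum_(d' k <= i < d k) s i ^+ 2.
Proof.
move=> E lsv sv /=; apply: le_trans (leading_lsv_gap lsv sv).
(* |W^H X|^2 = <X, W W^H X>, where W W^H X has the dimensions of X. *)
rewrite lmodeprod_adj hadjK lmodeprod_comp //; last exact: same_off_sym.
by rewrite -!(mdot_unfoldL k) unfoldL_lmodeprod -mulmxA mdot_adj hadjK.
Qed.

(** [unfoldR] transposes without conjugating, so its adjoint undoes the transpose and leaves an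
    entrywise conjugation. *)
Lemma hadj_unfoldR d k (X : qtensor R d) :
  hadj (unfoldR k X) = unfoldL k (tconj X).
Proof.
apply/matrixP => i j; have [a [<- aj]] := mode_index_exists i (ltn_ord j).
by rewrite hadjE [unfoldR _ _ _ _]mxE !unfoldLE // ffunE.
Qed.

(** Conjugating the tensor reduces this to [lmodeprod_gap]: the adjoint SVD swaps [U] and [V] and
    keeps the singular values. *)
Lemma rmodeprod_gap d d' k (X : qtensor R d) (W : 'M[H]_(d k, d' k)) s :
  same_off k d d' ->
  leading_rsv (unfoldR k X) W -> singular_values (unfoldR k X) s ->
  let Y : qtensor R d' := rmodeprod X W in
  tdot X X - tdot Y Y <= \sum_(d' k <= i < d k) s i ^+ 2.
Proof.
move=> E [le_d [U0 [s0 [V0 [svd WV]]]]] [U1 [V1 svd1]] /=.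
have := is_qsvd_hadj svd; have := is_qsvd_hadj svd1.
rewrite hadj_unfoldR => svd1' svd0'.
rewrite rmodeprodE tdot_conj -[tdot X X]tdot_conj; apply: lmodeprod_gap => //.
  by split=> //; exists V0, s0, U0.
by exists V1, U1.
Qed.

Lemma leading_rsv_iso p q r (M : 'M[H]_(p, q)) (W : 'M[H]_(q, r)) :
  leading_rsv M W -> hadj W *m W = 1%:M.
Proof.
by case=> le_rp [U [s [V [[[_ uV] _ _ _ _] WV]]]]; apply: leading_cols_iso uV WV.
Qed.

End TensorTheory.

(** * Chains of compressions and expansions *)

Section Chains.
Variables (R : realType) (m : nat).
Local Notation H := (quat R).
Local Notation N := (m + m)%N.
Variables I I' : 'I_N -> nat.
Variable U : forall i : 'I_m, 'M[H]_(I (lmode i), I' (lmode i)).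
Variable V : forall j : 'I_m, 'M[H]_(I (rmode j), I' (rmode j)).

Local Notation dims := (dims I I').
Local Notation castU := (castU U).
Local Notation castV := (castV V).
Local Notation lcompress t s := (@Defs.lcompress R m I I' U t s).
Local Notation rcompress t s := (@Defs.rcompress R m I I' V t s).
Local Notation lexpand t s := (@Defs.lexpand R m I I' U t s).
Local Notation rexpand t s := (@Defs.rexpand R m I I' V t s).

Lemma dims_cat s t l : dims (s ++ t) l = if l \in s then I' l else dims t l.
Proof. by rewrite /Defs.dims mem_cat; case: (l \in s). Qed.

Lemma same_off_dims_cons k t : same_off k (dims (k :: t)) (dims t).
Proof. by move=> l /negbTE lk; rewrite /Defs.dims inE lk. Qed.

Lemma same_off_dims_cat k s t1 t2 :
  same_off k (dims t1) (dims t2) -> same_off k (dims (s ++ t1)) (dims (s ++ t2)).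
Proof. by move=> E l lk; rewrite !dims_cat E. Qed.

Lemma lmode_rmode (i j : 'I_m) : lmode i != rmode j.
Proof. by rewrite eq_lrshift. Qed.

Lemma lcompress_adj t s (X : qtensor R (dims t)) Y :
  tdot (lcompress t s X) Y = tdot X (lexpand t s Y).
Proof.
elim: s Y => //= i s IHs Y.
by rewrite lmodeprod_adj hadjK IHs.
Qed.

Lemma rcompress_adj t s (X : qtensor R (dims t)) Y :
  tdot (rcompress t s X) Y = tdot X (rexpand t s Y).
Proof.
elim: s Y => //= i s IHs Y.
by rewrite rmodeprod_adj IHs.
Qed.

Lemma lcompressB t s (X Y : qtensor R (dims t)) :
  lcompress t s (X - Y) = lcompress t s X - lcompress t s Y.
Proof. by elim: s => //= i s ->; rewrite lmodeprodB. Qed.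

(** The factor at [i] is cast according to the modes [s2] truncated before it, hence a hypothesis
    over all splittings of [s]. *)
Lemma lexpandK t s :
  (forall s1 i s2, s = s1 ++ i :: s2 ->
     let W := castU (map (@lmode m) s2 ++ t) i in hadj W *m W = 1%:M) ->
  cancel (lexpand t s) (lcompress t s : qtensor R (dims t) -> _).
Proof.
elim: s => //= i s IHs isoU X; rewrite IHs => [|s1 i' s2 def_s].
  apply: lmodeprodK; last exact: (isoU [::]).
  exact/same_off_sym/same_off_dims_cons.
by apply: (isoU (i :: s1)); rewrite def_s.
Qed.

Lemma rexpandK t s :
  (forall s1 j s2, s = s1 ++ j :: s2 ->
     let W := castV (map (@rmode m) s2 ++ t) j in hadj W *m W = 1%:M) ->
  cancel (rexpand t s) (rcompress t s : qtensor R (dims t) -> _).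
Proof.
elim: s => //= j s IHs isoV X; rewrite IHs => [|s1 j' s2 def_s].
  apply: rmodeprodK; last exact: (isoV [::]).
  exact/same_off_sym/same_off_dims_cons.
by apply: (isoV (j :: s1)); rewrite def_s.
Qed.

Lemma lcompress_gap t s (X : qtensor R (dims t)) (e : 'I_m -> R) :
  (forall s1 i s2, s = s1 ++ i :: s2 ->
     tdot (lcompress t s2 X) (lcompress t s2 X) -
     tdot (lcompress t (i :: s2) X) (lcompress t (i :: s2) X) <= e i) ->
  tdot X X - tdot (lcompress t s X) (lcompress t s X) <= \sum_(i <- s) e i.
Proof.
elim: s => [|i s IHs] gap; first by rewrite big_nil subrr.
have gap_i := gap [::] i s erefl; rewrite big_cons [leRHS]addrC.
rewrite -(subrKA (tdot (lcompress t s X) (lcompress t s X))); apply: lerD => //.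
by apply: IHs => s1 i' s2 def_s; apply: (gap (i :: s1)); rewrite def_s.
Qed.

Lemma rcompress_gap t s (X : qtensor R (dims t)) (e : 'I_m -> R) :
  (forall s1 j s2, s = s1 ++ j :: s2 ->
     tdot (rcompress t s2 X) (rcompress t s2 X) -
     tdot (rcompress t (j :: s2) X) (rcompress t (j :: s2) X) <= e j) ->
  tdot X X - tdot (rcompress t s X) (rcompress t s X) <= \sum_(j <- s) e j.
Proof.
elim: s => [|j s IHs] gap; first by rewrite big_nil subrr.
have gap_j := gap [::] j s erefl; rewrite big_cons [leRHS]addrC.
rewrite -(subrKA (tdot (rcompress t s X) (rcompress t s X))); apply: lerD => //.
by apply: IHs => s1 j' s2 def_s; apply: (gap (j :: s1)); rewrite def_s.
Qed.

Lemma mx_entry_castU t1 t2 k i :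
  lmode i != k -> same_off k (dims t1) (dims t2) ->
  mx_entry (castU t1 i) =2 mx_entry (castU t2 i).
Proof.
move=> ik E; apply: mx_entry_conform; first exact: E.
by rewrite /Defs.dims !inE eqxx.
Qed.

Lemma dims_cat_rmode s t j :
  dims (map (@lmode m) s ++ t) (rmode j) = dims t (rmode j).
Proof.
rewrite dims_cat; case: ifP => // /mapP[i _ /eqP].
by rewrite eq_sym (negbTE (lmode_rmode i j)).
Qed.

(** Truncating left modes keeps the dimensions at [rmode j], but only propositionally; [B'] ranges
    over all matrices with the entries of [B], which lets the induction pick its own cast [B'']. *)
Lemma lcompress_rmodeprod s t1 t2 j (X : qtensor R (dims t1))
    (B : 'M[H]_(dims t1 (rmode j), dims t2 (rmode j)))
    (B' : 'M[H]_(dims (map (@lmode m) s ++ t1) (rmode j),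
                 dims (map (@lmode m) s ++ t2) (rmode j))) :
  same_off (rmode j) (dims t1) (dims t2) -> mx_entry B =2 mx_entry B' ->
  lcompress t2 s (rmodeprod X B) = rmodeprod (lcompress t1 s X) B'.
Proof.
elim: s B' => [|i s IHs] B' E eqB /=.
  apply/ffunP => a; rewrite !ffunE; apply: eq_bigr => b _.
  by rewrite !mx_entryE eqB.
pose B'' : 'M[H]_(dims (map (@lmode m) s ++ t1) (rmode j),
  dims (map (@lmode m) s ++ t2) (rmode j)) := conform_mx 0 B.
have eqB'' : mx_entry B'' =2 mx_entry B.
  by apply: mx_entry_conform_id; rewrite dims_cat_rmode.
rewrite (IHs B'') //.
have Es := same_off_dims_cat (map (@lmode m) s) E.
apply: lmodeprod_rmodeprod; rewrite ?lmode_rmode //.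
- exact/same_off_sym/same_off_dims_cons.
- exact/same_off_sym/same_off_dims_cons.
- exact: (same_off_dims_cat (map (@lmode m) (i :: s)) E).
- by move=> x y; rewrite !mx_entry_hadj (mx_entry_castU (lmode_rmode i j) Es).
- by move=> x y; rewrite eqB'' eqB.
Qed.

Lemma lexpand_rmodeprod s t1 t2 j
    (X : qtensor R (dims (map (@lmode m) s ++ t1)))
    (B : 'M[H]_(dims t1 (rmode j), dims t2 (rmode j)))
    (B' : 'M[H]_(dims (map (@lmode m) s ++ t1) (rmode j),
                 dims (map (@lmode m) s ++ t2) (rmode j))) :
  same_off (rmode j) (dims t1) (dims t2) -> mx_entry B =2 mx_entry B' ->
  lexpand t2 s (rmodeprod X B') = rmodeprod (lexpand t1 s X) B.
Proof.
elim: s X B' => [|i s IHs] X B' E eqB /=.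
  apply/ffunP => a; rewrite !ffunE; apply: eq_bigr => b _.
  by rewrite !mx_entryE eqB.
pose B'' : 'M[H]_(dims (map (@lmode m) s ++ t1) (rmode j),
  dims (map (@lmode m) s ++ t2) (rmode j)) := conform_mx 0 B.
have eqB'' : mx_entry B'' =2 mx_entry B.
  by apply: mx_entry_conform_id; rewrite dims_cat_rmode.
rewrite -(IHs _ B'') //.
have Es := same_off_dims_cat (map (@lmode m) s) E.
congr (lexpand t2 s _); apply: lmodeprod_rmodeprod; rewrite ?lmode_rmode //.
- exact: same_off_dims_cons.
- exact: same_off_dims_cons.
- exact: (same_off_dims_cat (map (@lmode m) (i :: s)) E).
- by move=> x y; rewrite (mx_entry_castU (lmode_rmode i j) Es).
- by move=> x y; rewrite eqB'' eqB.
Qed.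

(** Each right factor commutes with the left compression and then with the left expansion, hence
    with their composite. *)
Lemma rexpand_left_projection ls rs t
    (X : qtensor R (dims (map (@rmode m) rs ++ t))) :
  rexpand t rs (lexpand (map (@rmode m) rs ++ t) ls
    (lcompress (map (@rmode m) rs ++ t) ls X)) =
  lexpand t ls (lcompress t ls (rexpand t rs X)).
Proof.
elim: rs X => //= j rs IHrs X; rewrite -IHrs; congr (rexpand t rs _).
set t1 := rmode j :: _; set t2 := _ ++ t; set B := hadj _.
pose B' : 'M[H]_(dims (map (@lmode m) ls ++ t1) (rmode j),
  dims (map (@lmode m) ls ++ t2) (rmode j)) := conform_mx 0 B.
have eqB : mx_entry B =2 mx_entry B'.
  by move=> x y; rewrite mx_entry_conform_id // dims_cat_rmode.
have E : same_off (rmode j) (dims t1) (dims t2) := same_off_dims_cons _.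
by rewrite (lcompress_rmodeprod X E eqB) (lexpand_rmodeprod _ E eqB).
Qed.

(** The enumeration is strictly increasing. This identifies each intermediate tensor of a chain with
    the [Lhat_next] or [Rhat_prev] whose unfolding defines the next factor. *)
Lemma enum_ord_split (s1 s2 : seq 'I_m) i :
  enum 'I_m = s1 ++ i :: s2 -> s1 = rev (before i) /\ s2 = after i.
Proof.
move=> def_s; rewrite /before /after revK def_s.
have: pairwise (relpre val ltn) (s1 ++ i :: s2).
  rewrite -def_s -sorted_pairwise; last by move=> x y z; apply: ltn_trans.
  by rewrite -sorted_map val_enum_ord iota_ltn_sorted.
rewrite pairwise_cat /= => /and3P[/allrelP lt12 _ /andP[/allP lt2 _]].
have lt1 x : x \in s1 -> (x < i)%N by move=> s1x; apply: lt12 => //; apply: mem_head.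
rewrite !filter_cat /= !ltnn; split.
  rewrite (@eq_in_filter _ _ predT s1) ?filter_predT => [|x /lt1 //].
  rewrite (@eq_in_filter _ _ pred0 s2) ?filter_pred0 ?cats0 // => x /lt2.
  by rewrite /= => lt_ix; rewrite ltnNge ltnW.
rewrite (@eq_in_filter _ _ predT s2) ?filter_predT => [|x /lt2 //].
rewrite (@eq_in_filter _ _ pred0 s1) ?filter_pred0 // => x /lt1 lt_xi.
by rewrite /= ltnNge ltnW.
Qed.

End Chains.

(** * The error bound *)

Theorem theorem5 (R : realType) (m : nat) (I I' : 'I_(m + m) -> nat)
    (T That : qtensor R I)
    (U : forall i : 'I_m, 'M[quat R]_(I (lmode i), I' (lmode i)))
    (V : forall j : 'I_m, 'M[quat R]_(I (rmode j), I' (rmode j)))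
    (sigmaL sigmaR : 'I_m -> nat -> R) :
  (1 <= m)%N ->
  (forall k, (1 <= I' k <= I k)%N) ->
  truncated_TS_QHOSVD U V T That ->
  (forall i, singular_values (unfoldL (lmode i) (Lhat_next U T i)) (sigmaL i)) ->
  (forall j, singular_values (unfoldR (rmode j) (Rhat_prev V T j)) (sigmaR j)) ->
  frob (T - That : qtensor R I) ^+ 2 <=
    \sum_(i < m) \sum_(I' (lmode i) <= k < I (lmode i)) sigmaL i k ^+ 2 +
    \sum_(j < m) \sum_(I' (rmode j) <= k < I (rmode j)) sigmaR j k ^+ 2.
Proof.
move=> _ _ [[Ufac Vfac] ->] svL svR; set ls := enum 'I_m.
pose CL := @lcompress R m I I' U [::] ls; pose EL := @lexpand R m I I' U [::] ls.
pose CR := @rcompress R m I I' V [::] (rev ls).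
pose ER := @rexpand R m I I' V [::] (rev ls).
have split_l s1 i s2 : ls = s1 ++ i :: s2 -> s2 = after i.
  by case/enum_ord_split.
have split_r s1 j s2 : rev ls = s1 ++ j :: s2 -> s2 = before j.
  (* Reversed, the splitting reads ls = rev s2 ++ j :: rev s1. *)
  move/(congr1 rev); rewrite revK rev_cat rev_cons cat_rcons.
  by case/enum_ord_split => /(congr1 rev); rewrite !revK.
have ELK : cancel EL CL.
  apply: lexpandK => s1 i s2 /split_l ->; exact: leading_lsv_iso (Ufac i).
have ERK : cancel ER CR.
  apply: rexpandK => s1 j s2 /split_r ->; exact: leading_rsv_iso (Vfac j).
have adjL := lcompress_adj U (t := [::]) (s := ls).
have adjR := rcompress_adj V (t := [::]) (s := rev ls).
have -> : reconstruction U V T = EL (CL (ER (CR T))).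
  exact: (@rexpand_left_projection R m I I' U V ls (rev ls) [::] (CR T)).
(* With y = CL (ER (CR T)), the error becomes the left loss plus |CL T - CL (ER (CR T))|^2. *)
rewrite frob_sqr (coisometry_pythagoras (@tdot_inner _ _ _) (@tdot_inner _ _ _) adjL ELK).
have gapL : tdot T T - tdot (CL T) (CL T) <=
    \sum_(i < m) \sum_(I' (lmode i) <= k < I (lmode i)) sigmaL i k ^+ 2.
  rewrite -big_enum; apply: (@lcompress_gap _ _ _ _ U [::]) => s1 i s2 /split_l ->.
  have E := same_off_sym (@same_off_dims_cons m I I' (lmode i)
    (map (@lmode m) (after i) ++ [::])).
  apply: le_trans (lmodeprod_gap E (Ufac i) (svL i)) _.
  (* Mode [i] is absent from [after i], so this step cuts its dimension from [I] to [I']. *)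
  by rewrite /dims inE eqxx mem_cat orbF mem_map ?mem_filter ?ltnn //;
    apply: lshift_inj.
have gapR : tdot T T - tdot (CR T) (CR T) <=
    \sum_(j < m) \sum_(I' (rmode j) <= k < I (rmode j)) sigmaR j k ^+ 2.
  (* The right chain lists its modes in reverse order, so the sum is permuted to match. *)
  have -> : \sum_(j < m) \sum_(I' (rmode j) <= k < I (rmode j)) sigmaR j k ^+ 2 =
      \sum_(j <- rev ls) \sum_(I' (rmode j) <= k < I (rmode j)) sigmaR j k ^+ 2.
    by rewrite -big_enum; apply: perm_big; rewrite perm_sym perm_rev.
  apply: (@rcompress_gap _ _ _ _ V [::]) => s1 j s2 /split_r ->.
  have E := same_off_sym (@same_off_dims_cons m I I' (rmode j)
    (map (@rmode m) (before j) ++ [::])).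
  apply: le_trans (rmodeprod_gap E (Vfac j) (svR j)) _.
  by rewrite /dims inE eqxx mem_cat orbF mem_map ?mem_rev ?mem_filter ?ltnn //;
    apply: rshift_inj.
(* [CL] is additive and contracts, so the remaining term is at most |T - ER (CR T)|^2, which is the
   right loss. *)
apply: lerD => //; apply: le_trans gapR.
rewrite -(coisometry_gap (@tdot_inner _ _ _) (@tdot_inner _ _ _) adjR ERK).
rewrite -lcompressB.
exact: (coisometry_contracts (@tdot_inner _ _ _) (@tdot_inner _ _ _) adjL ELK).
Qed.
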